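(* Let $G$ be a virtually-$\mathbb{Z}$ group with a finite symmetric generating set $S$, and let $H$ be a nontrivial finite group. Then there exists $1<\lambda_c<\infty$ such that the $\lambda$-stationary random walk on $H\wr G$ (with uniform switch measure on $H$) is transient if $\lambda<\lambda_c$ and recurrent if $\lambda>\lambda_c$. Moreover, the value of $\lambda_c$ depends on $H$ only through $|H|$.
   Context: The lamplighter group $H\wr G$ consists of pairs $((L(g))_{g\in G},x)$ with $L:G\to H$ finitely supported and $x\in G$; its identity has all lamps $\mathrm{id}_H$ and $x=\mathrm{id}_G$. The $\lambda$-homesick random walk ($\lambda\ge1$) on the Cayley graph $\mathrm{Cay}(G,S)$ (vertices $G$, $g$ adjacent to $gs$ for $s\in S$), rooted at $o=\mathrm{id}_G$: $Z_0=o$; if at vertex $v$ the neighbors $v_1,\dots,v_j$ satisfy $\mathrm{dist}(o,v_i)=\mathrm{dist}(o,v)-1$ and $v'_1,\dots,v'_k$ are the other neighbors, the walk moves to each $v_i$ with probability $\frac{\lambda}{\lambda j+k}$ and to each $v'_i$ with probability $\frac{1}{\lambda j+k}$. Given a probability measure $\mu$ on $H$, the $\lambda$-stationary random walk on $H\wr G$ is $R_n=((L_n(g))_g,Z_n)$ where $Z_n$ is the $\lambda$-homesick walk, $L_0\equiv\mathrm{id}_H$, $(U_n)_{n\ge1},(V_n)_{n\ge1}$ are i.i.d. $\mu$-distributed and independent of $(Z_n)$, and $L_{n+1}(g)=L_n(g)$ for $g\notin\{Z_n,Z_{n+1}\}$, $L_{n+1}(Z_n)=L_n(Z_n)U_{n+1}$,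 $L_{n+1}(Z_{n+1})=L_n(Z_{n+1})V_{n+1}$. Here $\mu$ is the uniform measure on $H$. Recurrent/transient mean returning to the identity infinitely/finitely often almost surely. *)

(* Defs.v *)
From mathcomp Require Import all_boot all_order all_algebra all_fingroup.
From mathcomp Require Import reals boolp.

Set Implicit Arguments.
Unset Strict Implicit.
Unset Printing Implicit Defensive.

Import Order.TTheory GRing.Theory Num.Theory.

Section CayleyGraph.
Variable G : groupType.
Variable S : seq G.

(** [S] is a finite symmetric generating set of [G] (as a set of vertices of
    a simple Cayley graph: no repetitions, identity not a generator). *)
Definition symmetric_gen_set : Prop :=
  [/\ uniq S, (1%g \notin S),
      (forall x, x \in S -> (x^-1)%g \in S) &
      (forall g : G, exists w : seq G, all (mem S) w /\ g = (\prod_(x <- w) x)%g)].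

Definition word_of (n : nat) (v : G) : Prop :=
  exists w : seq G, [/\ size w = n, all (mem S) w & v = (\prod_(x <- w) x)%g].

Definition is_dist (v : G) (n : nat) : Prop :=
  word_of n v /\ forall m, (m < n)%N -> ~ word_of m v.

Definition closer (v s : G) : Prop :=
  exists n, is_dist v n.+1 /\ is_dist (v * s)%g n.

End CayleyGraph.

Definition virtually_Z (G : groupType) : Prop :=
  exists g : G,
    (forall n : nat, (0 < n)%N -> (g ^+ n)%g != 1%g) /\
    exists reps : seq G, forall x : G, exists2 r, r \in reps &
      exists n : nat, x = (r * g ^+ n)%g \/ x = (r * (g ^+ n)^-1)%g.

Local Open Scope ring_scope.

Section LamplighterWalk.
Variables (R : realType) (G : groupType) (S : seq G) (H : finGroupType).
Variable lambda : R.

Definition hs_weight (v s : G) : R := if `[< closer S v s >] then lambda else 1.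

Definition hs_prob (v : G) (i : nat) : R :=
  hs_weight v (nth 1%g S i) / \sum_(j < size S) hs_weight v (nth 1%g S j).

(** the random input of one step: the generator index of the move of Z,
    and the two switch values U_{n+1}, V_{n+1} in H *)
Definition choice := ('I_(size S) * H * H)%type.

Definition lstate := ((G -> H) * G)%type.

Definition lstate_id : lstate := (fun _ => 1%g, 1%g).

Definition lstep (st : lstate) (c : choice) : lstate :=
  let z := st.2 in
  let z' := (z * nth 1%g S c.1.1)%g in
  (fun g => if g == z then (st.1 g * c.1.2)%g
            else if g == z' then (st.1 g * c.2)%g else st.1 g, z').

Definition ltraj (cs : seq choice) : seq lstate := scanl lstep lstate_id cs.

(** probability of the first N inputs: homesick transitions for Z times the
    uniform law mu on H for each of U and V *)
Fixpoint path_weight (z : G) (cs : seq choice) : R :=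
  match cs with
  | [::] => 1
  | c :: cs' => hs_prob z c.1.1 / (#|H|%:R ^+ 2)
                * path_weight (z * nth 1%g S c.1.1)%g cs'
  end.

Definition prob_upto (N : nat) (E : seq lstate -> bool) : R :=
  \sum_(t : N.-tuple choice) path_weight 1%g t * (if E (ltraj t) then 1 else 0).

Definition nreturns (sts : seq lstate) : nat :=
  count (fun st => `[< st = lstate_id >]) sts.

(** Recurrence: P(R_n = id infinitely often) = 1, i.e. (continuity of the
    path measure) for every m, P(at least m returns) = 1, where
    P(at least m returns) = sup_N P(at least m returns by time N). *)
Definition lamp_recurrent : Prop :=
  forall (m : nat) (eps : R), 0 < eps ->
    exists N, 1 - eps <= prob_upto N (fun sts => (m <= nreturns sts)%N).

(** Transience: P(R_n = id infinitely often) = 0, i.e.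
    inf_m sup_N P(at least m returns by time N) = 0. *)
Definition lamp_transient : Prop :=
  forall eps : R, 0 < eps ->
    exists m : nat, forall N, prob_upto N (fun sts => (m <= nreturns sts)%N) <= eps.

End LamplighterWalk.

(* Main.v *)
(* At any time n >= 1 the lamps at the sites visited by the homesick walk are
   independent and uniform, so P(R_n = id) = E[|H|^-|range of Z|; Z_n = id], and
   by renewal the lamplighter walk is recurrent iff these numbers have infinite
   sum.  The homesick walk is reversible for the edge conductances
   lambda^-min(|x|,|y|).  Let b_r be the size of the ball of radius r.

   - Killed outside the ball of radius r, the walk returns to the identity at
     least lambda^r / (2 b_r) times on average, because the edges leaving the
     ball have total conductance at most |S| b_r lambda^-r; hence the sum is at
     least about |H|^-b_r lambda^r / b_r for every r.
   - Conversely, if r + 1 is the first radius whose ball is not yet covered, the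
     range has at least b_r sites and misses some v with |v| = r + 1; the energy
     of the potential killed at v shows that the walk returns at most
     |S| (r + 1)^2 lambda^r times on average before hitting v.

   As r < b_r = O(r), the polynomial factors are harmless and the threshold is
   the supremum of the x for which |H|^-b_r x^r stays bounded in r; it lies
   between |H| and a power of |H|. *)
Require Import Defs.
From mathcomp Require Import all_boot all_order all_algebra all_fingroup.
From mathcomp Require Import reals boolp.
From mathcomp Require Import ring lra zify.

Set Implicit Arguments.
Unset Strict Implicit.
Unset Printing Implicit Defensive.

Import Order.TTheory GRing.Theory Num.Theory.
Local Open Scope ring_scope.

(** * Expectations along finite Markov trajectories *)

Lemma big_tuple_cons (R : Type) (idx : R) (op : Monoid.com_law idx)
    (C : finType) (n : nat) (F : n.+1.-tuple C -> R) :
  \big[op/idx]_(t : n.+1.-tuple C) F t =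
  \big[op/idx]_(c : C) \big[op/idx]_(t : n.-tuple C) F [tuple of c :: t].
Proof.
rewrite pair_big /= (reindex (fun p : C * n.-tuple C => [tuple of p.1 :: p.2])) //.
exists (fun t => (thead t, [tuple of behead t])) => [[c t] _|t _] /=.
  by congr pair; apply: val_inj.
by rewrite -tuple_eta.
Qed.

Section Chain.
Variables (R : realFieldType) (X : Type) (C : finType).
Variables (w : X -> C -> R) (step : X -> C -> X).

Fixpoint traj_weight (x : X) (cs : seq C) : R :=
  if cs is c :: cs' then w x c * traj_weight (step x c) cs' else 1.

(** The list passed to [F] starts after the first step and does not contain [x], so visits are
    counted from time 1 on. *)
Fixpoint expect (n : nat) (x : X) (F : seq X -> R) : R :=
  if n is n'.+1 then
    \sum_c w x c * expect n' (step x c) (fun l => F (step x c :: l))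
  else F [::].

Lemma expectS n x F : expect n.+1 x F =
  \sum_c w x c * expect n (step x c) (fun l => F (step x c :: l)).
Proof. by []. Qed.

Lemma expect_tuple n x F :
  \sum_(t : n.-tuple C) traj_weight x t * F (scanl step x t) = expect n x F.
Proof.
elim: n x F => [|n IHn] x F.
  rewrite (big_pred1 [tuple]) => [|t]; first by rewrite /= mul1r.
  by rewrite [t]tuple0 /= eqxx.
rewrite big_tuple_cons /=; apply: eq_bigr => c _.
rewrite -IHn big_distrr /=; apply: eq_bigr => t _.
by rewrite mulrA.
Qed.

Lemma eq_expect n x F G : F =1 G -> expect n x F = expect n x G.
Proof.
elim: n x F G => [|n IHn] x F G FG /=; first exact: FG.
by apply: eq_bigr => c _; congr (_ * _); apply: IHn => l; apply: FG.
Qed.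

Lemma expectZ n x a F : expect n x (fun l => a * F l) = a * expect n x F.
Proof.
elim: n x F => [//|n IHn] x F /=.
rewrite big_distrr; apply: eq_bigr => c _.
by rewrite (IHn _ (fun l => F (_ :: l))) mulrCA.
Qed.

Lemma expect_sum (I : Type) (r : seq I) (P : pred I) n x (F : I -> seq X -> R) :
  expect n x (fun l => \sum_(i <- r | P i) F i l) =
  \sum_(i <- r | P i) expect n x (F i).
Proof.
elim: n x F => [//|n IHn] x F /=.
rewrite exchange_big; apply: eq_bigr => c _ /=.
by rewrite (IHn _ (fun i l => F i (_ :: l))) big_distrr.
Qed.

Lemma expectD n x F G :
  expect n x (fun l => F l + G l) = expect n x F + expect n x G.
Proof.
elim: n x F G => [//|n IHn] x F G /=.
rewrite -big_split; apply: eq_bigr => c _ /=.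
by rewrite (IHn _ (fun l => F (_ :: l)) (fun l => G (_ :: l))) mulrDr.
Qed.

Hypothesis w_ge0 : forall x c, 0 <= w x c.

(** Allows expectations to be compared on trajectories made of genuine steps only; this is what
    confines [n] steps to a ball. *)
Fixpoint is_traj (x : X) (l : seq X) : Prop :=
  if l is y :: l' then (exists c, y = step x c) /\ is_traj y l' else True.

Lemma ler_expect n x F G :
  (forall l, size l = n -> is_traj x l -> F l <= G l) ->
  expect n x F <= expect n x G.
Proof.
elim: n x F G => [|n IHn] x F G FG /=; first exact: FG.
apply: ler_sum => c _; apply: ler_wpM2l => //.
apply: IHn => l sl tl; apply: FG; first by rewrite /= sl.
by split=> //; exists c.
Qed.

Hypothesis w_sum : forall x, \sum_c w x c = 1.

Lemma expect_cst n x a : expect n x (fun=> a) = a.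
Proof.
elim: n x => [//|n IHn] x /=.
by under eq_bigr => c _ do rewrite IHn; rewrite -big_distrl /= w_sum mul1r.
Qed.

Lemma expect_ge0 n x F : (forall l, 0 <= F l) -> 0 <= expect n x F.
Proof. by move=> F0; rewrite -(expect_cst n x 0); apply: ler_expect => l _ _. Qed.

(** * Renewal inequalities for returns to a fixed state *)

Section Returns.
Variables (a : pred X) (x0 : X).
Hypothesis aP : forall x, a x -> x = x0.

Definition returns_ge (N m : nat) (x : X) : R :=
  expect N x (fun l => (m <= count a l)%N%:R).

Definition mean_returns (N : nat) (x : X) : R :=
  expect N x (fun l => (count a l)%:R).

Definition return_prob (n : nat) (x : X) : R :=
  expect n x (fun l => (a (last x l))%:R).

Lemma returns_ge_ge0 N m x : 0 <= returns_ge N m x.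
Proof. by apply: expect_ge0 => l; rewrite ler0n. Qed.

Lemma returns_ge_le1 N m x : returns_ge N m x <= 1.
Proof.
rewrite -[leRHS](expect_cst N x 1); apply: ler_expect => l _ _.
by rewrite lern1 leq_b1.
Qed.

Lemma returns_ge0 N x : returns_ge N 0 x = 1.
Proof. exact: expect_cst. Qed.

Lemma returns_geS N m x : returns_ge N.+1 m.+1 x =
  \sum_c w x c * if a (step x c) then returns_ge N m x0
                 else returns_ge N m.+1 (step x c).
Proof.
apply: eq_bigr => c _; congr (_ * _) => /=.
by case: ifPn => [/aP ->|_]; apply: eq_expect => l /=.
Qed.

Lemma mean_returnsS N x : mean_returns N.+1 x =
  \sum_c w x c * ((a (step x c))%:R + mean_returns N (step x c)).
Proof.
apply: eq_bigr => c _; congr (_ * _) => /=.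
rewrite -[X in X + _](expect_cst N (step x c)) -expectD.
by apply: eq_expect => l; rewrite natrD.
Qed.

Lemma mean_returns_ge0 N x : 0 <= mean_returns N x.
Proof. by apply: expect_ge0 => l; rewrite ler0n. Qed.

Lemma mean_returnsSr N x :
  mean_returns N.+1 x = mean_returns N x + return_prob N.+1 x.
Proof.
elim: N x => [|N IHN] x.
  rewrite mean_returnsS /mean_returns /return_prob /= add0r.
  by under eq_bigr => c _ do rewrite addr0.
rewrite mean_returnsS [in RHS]mean_returnsS -big_split; apply: eq_bigr => c _ /=.
by rewrite IHN addrA mulrDr.
Qed.

Lemma mean_returnsE N x : mean_returns N x = \sum_(1 <= n < N.+1) return_prob n x.
Proof.
elim: N => [|N IHN]; first by rewrite big_geq.
by rewrite big_nat_recr //= -IHN mean_returnsSr.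
Qed.

Lemma mean_returns_leS N x : mean_returns N x <= mean_returns N.+1 x.
Proof. by rewrite mean_returnsSr lerDl; apply: expect_ge0 => l; rewrite ler0n. Qed.

Lemma returns_ge_leS N m x : returns_ge N m x <= returns_ge N.+1 m x.
Proof.
elim: N m x => [|N IHN] [|m] x; rewrite ?returns_ge0 //.
  by rewrite {1}/returns_ge /= returns_ge_ge0.
rewrite !returns_geS; apply: ler_sum => c _; apply: ler_wpM2l => //.
by case: ifP.
Qed.

Lemma markov_returns N m x : m%:R * returns_ge N m x <= mean_returns N x.
Proof.
rewrite -expectZ; apply: ler_expect => l _ _.
by case: leqP => ml; rewrite ?mulr1 ?mulr0 ?ler_nat.
Qed.

(** Renewal at the first return: it counts for one, and the later returns are those of a fresh walk
    from [x0] with at most [N] steps left. *)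
Lemma mean_returns_le N x :
  mean_returns N x <= returns_ge N 1 x * (1 + mean_returns N x0).
Proof.
elim: N x => [|N IHN] x; first by rewrite /mean_returns /returns_ge /= mul0r.
have H : 1 + mean_returns N x0 <= 1 + mean_returns N.+1 x0.
  by rewrite lerD2l mean_returns_leS.
apply: le_trans (ler_wpM2l (returns_ge_ge0 _ _ _) H).
rewrite mean_returnsS returns_geS big_distrl /=; apply: ler_sum => c _.
rewrite -mulrA; apply: ler_wpM2l => //.
case: ifPn => [/aP ->|_]; last by rewrite add0r.
by rewrite returns_ge0 mul1r.
Qed.

(** Strong Markov property at the first return, obtained by induction on the first step: it suffices
    to return once within [N] steps and then [m] times within [M] further steps. *)
Lemma returns_geD N M m x :
  returns_ge N 1 x * returns_ge M m x0 <= returns_ge (N + M) m.+1 x.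
Proof.
elim: N x => [|N IHN] x.
  by rewrite {1}/returns_ge /= mul0r returns_ge_ge0.
rewrite addSn !returns_geS big_distrl /=; apply: ler_sum => c _.
rewrite -mulrA; apply: ler_wpM2l => //.
case: ifPn => // _; rewrite returns_ge0 mul1r addnC.
(* After a return at the very first step more than [M] steps may remain; extra time only helps. *)
by elim: N {IHN} => [|N IHN]; rewrite ?addn0 ?addnS // (le_trans IHN) ?returns_ge_leS.
Qed.

(** Markov's inequality. The Archimedean bound is a hypothesis because [R] is an arbitrary ordered
    field here. *)
Lemma bounded_mean_returns_transient (B : R) :
  (forall N, mean_returns N x0 <= B) ->
  forall eps : R, 0 < eps -> (exists k : nat, B / eps < k%:R) ->
  exists m, forall N, returns_ge N m x0 <= eps.
Proof.
move=> HB eps e0 [k hk]; exists k => N.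
have k0 : 0 < k%:R :> R.
  apply: le_lt_trans hk; apply: divr_ge0; last exact: ltW.
  by apply: le_trans (HB 0%N); rewrite mean_returns_ge0.
rewrite -(ler_pM2l k0); apply: le_trans (markov_returns _ _ _) _.
by apply: le_trans (HB N) _; rewrite -ler_pdivrMr // ltW.
Qed.

Lemma unbounded_mean_returns_recurrent :
  (forall B : R, exists N, B < mean_returns N x0) ->
  forall m (eps : R), 0 < eps -> exists N, 1 - eps <= returns_ge N m x0.
Proof.
move=> HB.
have ret1 (eps : R) : 0 < eps -> exists N, 1 - eps <= returns_ge N 1 x0.
  (* With mean [e] and return probability [q], renewal gives e <= q (1 + e), hence 1 - q <= 1 / e <
     eps. *)
  move=> e0; have [N hN] := HB (eps^-1); exists N.
  have := mean_returns_le N x0; have := returns_ge_le1 N 1 x0.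
  set e := mean_returns _ _ in hN *; set q := returns_ge _ _ _ => q1 he.
  rewrite leNgt; apply/negP => q2.
  have ee : 1 < e * eps by rewrite -ltr_pdivrMr // mul1r.
  have i0 : 0 < eps^-1 by rewrite invr_gt0.
  nra.
elim=> [|m IHm] eps e0; first by exists 0%N; rewrite returns_ge0; lra.
have e2 : 0 < eps / 2 by lra.
have [N hN] := ret1 _ e2; have [M hM] := IHm _ e2.
exists (N + M)%N; apply: le_trans (returns_geD _ _ _ _).
have := returns_ge_le1 N 1 x0; have := returns_ge_le1 M m x0.
by nra.
Qed.

End Returns.
End Chain.

Arguments expect : simpl never.

(** * Lamps along a trajectory *)

Lemma sum_triple (R : nmodType) (I J K : finType) (F : I * J * K -> R) :
  \sum_c F c = \sum_i \sum_j \sum_k F (i, j, k).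
Proof. by rewrite pair_big /= pair_big; apply: eq_bigr => -[[]]. Qed.

Lemma sum_indicator_eq (R : pzSemiRingType) (I : finType) (a : I) :
  \sum_i (i == a)%:R = 1 :> R.
Proof.
rewrite (bigD1 a) //= eqxx big1 ?addr0 // => i /negPf ->.
by [].
Qed.

Lemma sum_cst (R : pzSemiRingType) (I : finType) (x : R) :
  \sum_(i : I) x = #|I|%:R * x.
Proof. by rewrite sumr_const mulr_natl. Qed.

Section LampReturns.
Variables (R : realType) (G : groupType) (S : seq G) (H : finGroupType).
Variable lambda : R.
Hypothesis S1 : 1%g \notin S.

Definition walk_weight (z : G) (i : 'I_(size S)) : R := hs_prob S lambda z i.
Definition walk_step (z : G) (i : 'I_(size S)) : G := (z * nth 1%g S i)%g.
Definition lamp_weight (st : lstate G H) (c : Defs.choice S H) : R :=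
  hs_prob S lambda st.2 c.1.1 / (#|H|%:R ^+ 2).
Definition is_id (st : lstate G H) : bool := `[< st = lstate_id G H >].

Lemma prob_uptoE N (E : seq (lstate G H) -> bool) :
  prob_upto S lambda N E =
  expect lamp_weight (@lstep G S H) N (lstate_id G H) (fun l => (E l)%:R).
Proof.
rewrite -expect_tuple; apply: eq_bigr => t _; congr (_ * _); last by case: (E _).
rewrite -[1%g]/((lstate_id G H).2); move: (lstate_id G H) => st.
by elim: (tval t) st => [//|c cs IHcs] st /=; rewrite -IHcs.
Qed.

Lemma walk_step_neq z i : walk_step z i != z.
Proof.
apply: contraNneq S1 => zi; have {1}<- : nth 1%g S i = 1%g.
  by apply: (mulgI z); rewrite mulg1.
exact: mem_nth.
Qed.

(** Lamps off the trajectory never change, so from lamps [L] the identity is reachable along [l]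
    only under this condition. *)
Definition lamps_off (L : G -> H) (l : seq G) : bool :=
  `[< forall g, g \notin l -> L g = 1%g >].

Lemma lamps_off_cons (L : G -> H) x l :
  lamps_off L l = lamps_off L (x :: l) && ((x \in l) || (L x == 1%g)).
Proof.
apply/asboolP/andP => [Ll|[/asboolP Lxl xl] g gl].
  split; first by apply/asboolP=> g; rewrite in_cons negb_or => /andP[_ /Ll].
  by case: (boolP (x \in l)) => //= /Ll ->.
have [gx|gx] := eqVneq g x; last by apply: Lxl; rewrite in_cons negb_or gx.
by move: xl; rewrite -gx (negPf gl) => /eqP.
Qed.

(** As 1 is not in [S], the two switches act on different lamps, so each must be the inverse of the
    lamp it multiplies. *)
Lemma lstep_id (L : G -> H) z i u v :
  is_id (lstep (L, z) (i, u, v)) =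
  [&& walk_step z i == 1%g, lamps_off L [:: z; walk_step z i],
      u == (L z)^-1%g & v == (L (walk_step z i))^-1%g].
Proof.
have zz := walk_step_neq z i.
apply/asboolP/and4P => [|[/eqP z1 /asboolP L1 /eqP -> /eqP ->]].
  move=> [Lid z1]; have Lg g := congr1 (@^~ g) Lid.
  split; first exact/eqP.
  - apply/asboolP => g; rewrite !in_cons in_nil orbF negb_or => /andP[g1 g2].
    by have := Lg g; rewrite (negPf g1) -/(walk_step z i) (negPf g2).
  - by rewrite eq_sym eq_invg_mul; have := Lg z; rewrite eqxx => ->.
  - rewrite eq_sym eq_invg_mul; have := Lg (walk_step z i).
    by rewrite (negPf zz) eqxx => ->.
rewrite /lstep /= -/(walk_step z i) z1; congr pair; apply: funext => g.
case: eqVneq => [->|gz]; first by rewrite mulgV.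
case: eqVneq => [->|g1]; first by rewrite mulgV.
by apply: L1; rewrite !in_cons in_nil orbF negb_or z1 gz.
Qed.

(** The lamp at the new site can still be corrected, whatever [v] is; the one at [z] must be right
    after this step unless [z] is visited again. *)
Lemma lamps_off_lstep (L : G -> H) z i u v l :
  let L' := (lstep (L, z) (i, u, v)).1 in
  lamps_off L' (walk_step z i :: l) =
  lamps_off L (z :: walk_step z i :: l) && ((z \in l) || (u == (L z)^-1%g)).
Proof.
move=> L'; have zz := walk_step_neq z i; rewrite (lamps_off_cons _ z).
congr (_ && _).
  apply/asboolP/asboolP => LL g gzl; have := LL g gzl; rewrite /L' /=;
    move: gzl; rewrite !in_cons !negb_or => /and3P[g1 g2 _].
    by rewrite (negPf g1) -/(walk_step z i) (negPf g2).
  by rewrite (negPf g1) -/(walk_step z i) (negPf g2).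
rewrite in_cons eq_sym (negPf zz) /= /L' /= eqxx; congr (_ || _).
by rewrite [in RHS]eq_sym eq_invg_mul.
Qed.

(* The lamps at the vertices visited by a nonconstant trajectory are
   independent and uniform at its end. *)
Lemma lamp_return_prob n (L : G -> H) z :
  return_prob lamp_weight (@lstep G S H) is_id n.+1 (L, z) =
  expect walk_weight walk_step n.+1 z (fun l =>
    (last z l == 1%g)%:R * #|H|%:R ^- size (undup (z :: l)) *
    (lamps_off L (z :: l))%:R).
Proof.
have h0 : #|H|%:R != 0 :> R by rewrite pnatr_eq0 -lt0n; apply/card_gt0P; exists 1%g.
elim: n L z => [|n IHn] L z.
  rewrite /return_prob /expect sum_triple; apply: eq_bigr => i _.
  have zz := walk_step_neq z i.
  (* Exactly one pair of switch values succeeds, and the two sites are distinct, whence the exponent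
     2. *)
  transitivity (\sum_(u : H) \sum_(v : H)
      (walk_weight z i * #|H|%:R ^- 2 * (walk_step z i == 1%g)%:R *
       (lamps_off L [:: z; walk_step z i])%:R) *
      (u == (L z)^-1%g)%:R * (v == (L (walk_step z i))^-1%g)%:R).
    apply: eq_bigr => u _; apply: eq_bigr => v _.
    rewrite [last _ _]/= lstep_id !andbA -!mulnb !natrM !mulrA.
    by rewrite /lamp_weight /walk_weight.
  under eq_bigr => u _ do rewrite -big_distrr /= sum_indicator_eq mulr1.
  rewrite -big_distrr /= sum_indicator_eq mulr1.
  have -> : size (undup [:: z; walk_step z i]) = 2%N.
    by rewrite /= mem_seq1 eq_sym (negPf zz).
  by rewrite -!mulrA; congr (_ * (_ * _)); rewrite mulrCA.
rewrite /return_prob expectS sum_triple expectS; apply: eq_bigr => i _.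
set zi := walk_step z i.
pose L' u v := (lstep (L, z) (i, u, v)).1.
pose F u v l : R := (last zi l == 1%g)%:R * #|H|%:R ^- size (undup (zi :: l)) *
  (lamps_off (L' u v) (zi :: l))%:R.
transitivity (walk_weight z i * expect walk_weight walk_step n.+1 zi
    (fun l => \sum_(u : H) \sum_(v : H) #|H|%:R ^- 2 * F u v l)).
  rewrite (expect_sum _ _ _ _ _ _ (fun u l => \sum_v #|H|%:R ^- 2 * F u v l)).
  rewrite big_distrr; apply: eq_bigr => u _ /=.
  rewrite (expect_sum _ _ _ _ _ _ (fun v l => #|H|%:R ^- 2 * F u v l)).
  rewrite big_distrr; apply: eq_bigr => v _ /=.
  rewrite expectZ mulrA; congr (_ * _).
  exact: (IHn (L' u v) zi).
congr (_ * _); apply: eq_expect => l.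
under eq_bigr => u _ do under eq_bigr => v _ do
  rewrite /F /L' lamps_off_lstep -mulnb natrM.
rewrite -/zi; have zl : (z \in zi :: l) = (z \in l).
  by rewrite in_cons eq_sym (negPf (walk_step_neq z i)).
rewrite [last z _]/=; move: (zi :: l) zl => l1 zl; rewrite [undup (z :: l1)]/= zl.
(* If [z] is revisited, both switches are free and averaging cancels the factor |H|^-2. Otherwise
   [u] is forced and one factor |H|^-1 survives, which accounts for the additional site [z] in the
   range. *)
case: (z \in l) => /=.
  by rewrite !sum_cst; field; rewrite expf_neq0.
set X : R := _ / _; set Y : R := (lamps_off _ _)%:R.
transitivity (\sum_u (#|H|%:R^-1 * (X * Y)) * (u == (L z)^-1%g)%:R).
  by apply: eq_bigr => u _; rewrite sum_cst; field.
rewrite -big_distrr sum_indicator_eq /= exprS /X; field.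
by rewrite expf_neq0.
Qed.
End LampReturns.

(** * Green functions of killed reversible walks *)

Lemma ler_term_sum (R : numDomainType) (T : eqType) (r : seq T) (F : T -> R) x :
  (forall y, 0 <= F y) -> x \in r -> F x <= \sum_(y <- r) F y.
Proof.
move=> F0; elim: r => [//|y r IHr]; rewrite big_cons in_cons.
case/orP => [/eqP <-|/IHr]; first by rewrite lerDl sumr_ge0.
by move/le_trans; apply; rewrite lerDr.
Qed.

Lemma ler_term_sum2 (R : numDomainType) (T : eqType) (r : seq T) (F : T -> R) x y :
  (forall z, 0 <= F z) -> uniq r -> x \in r -> y \in r -> x != y ->
  F x + F y <= \sum_(z <- r) F z.
Proof.
move=> F0 r_uniq xr yr xy; rewrite (bigD1_seq x) //= lerD2l big_mkcond /=.
have := @ler_term_sum R T r (fun z => if z != x then F z else 0) y.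
by rewrite eq_sym xy; apply=> // z; case: ifP.
Qed.

Section KilledGreen.
Variables (R : realFieldType) (T : eqType) (A : seq T).
Variables (c : T -> T -> R) (pi : T -> R) (o : T).
Hypotheses (A_uniq : uniq A) (oA : o \in A).
Hypotheses (c_sym : forall x y, c x y = c y x) (c_ge0 : forall x y, 0 <= c x y).
Hypotheses (pi_gt0 : forall x, 0 < pi x).
Hypothesis c_le : forall x, \sum_(y <- A) c x y <= pi x.

(** The chance that the walk from [x], killed on stepping out of [A], is at [o] at time [n]. The
    starting point need not lie in [A]. *)
Fixpoint hit_prob (n : nat) (x : T) : R :=
  if n is n'.+1 then \sum_(y <- A) c x y / pi x * hit_prob n' y else (x == o)%:R.

(** The Green function truncated at time [N], so that no convergence question arises; bounds will be
    uniform in [N]. *)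
Definition green (N : nat) (x : T) : R := \sum_(0 <= n < N.+1) hit_prob n x.

Lemma hit_prob_ge0 n x : 0 <= hit_prob n x.
Proof.
elim: n x => [|n IHn] x /=; first by rewrite ler0n.
by apply: sumr_ge0 => y _; rewrite mulr_ge0 // divr_ge0 // ltW.
Qed.

Lemma green_ge0 N x : 0 <= green N x.
Proof. by apply: sumr_ge0 => n _; apply: hit_prob_ge0. Qed.

Lemma greenSr N x : green N.+1 x = green N x + hit_prob N.+1 x.
Proof. by rewrite /green big_nat_recr. Qed.

Lemma green_leS N x : green N x <= green N.+1 x.
Proof. by rewrite greenSr lerDl hit_prob_ge0. Qed.

Lemma greenS N x :
  green N.+1 x = (x == o)%:R + \sum_(y <- A) c x y / pi x * green N y.
Proof.
rewrite /green big_nat_recl //=; congr (_ + _).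
rewrite exchange_big /=; apply: eq_bigr => y _.
by rewrite big_distrr.
Qed.

(** The Poisson equation of the Green function; truncation adds the last term, whose sign is
    favourable in the energy bound. *)
Lemma green_poisson N x :
  pi x * green N x - \sum_(y <- A) c x y * green N y =
  pi x * (x == o)%:R - pi x * hit_prob N.+1 x.
Proof.
have -> : \sum_(y <- A) c x y * green N y =
    pi x * \sum_(y <- A) c x y / pi x * green N y.
  rewrite big_distrr; apply: eq_bigr => y _ /=.
  by field; rewrite gt_eqF.
have := greenS N x; rewrite greenSr => /(canRL (addrK _)) ->.
by ring.
Qed.

Definition killing (x : T) : R := pi x - \sum_(y <- A) c x y.

Lemma killing_ge0 x : 0 <= killing x.
Proof. by rewrite subr_ge0. Qed.

(** Discrete integration by parts: expand the squares and use symmetry of [c]. The half appears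
    because each edge is summed in both directions. *)
Lemma dirichlet_form (g : T -> R) :
  \sum_(x <- A) g x * (pi x * g x - \sum_(y <- A) c x y * g y) =
  (\sum_(x <- A) \sum_(y <- A) c x y * (g x - g y) ^+ 2) / 2 +
  \sum_(x <- A) killing x * g x ^+ 2.
Proof.
set D := \sum_(x <- A) \sum_(y <- A) c x y * (g x - g y) ^+ 2.
set B := \sum_(x <- A) \sum_(y <- A) c x y * (g x * g y).
set Q := \sum_(x <- A) \sum_(y <- A) c x y * g x ^+ 2.
have QE : Q = \sum_(x <- A) \sum_(y <- A) c x y * g y ^+ 2.
  by rewrite /Q exchange_big; apply: eq_bigr => x _; apply: eq_bigr => y _; rewrite c_sym.
have DE : D = Q + Q - 2 * B.
  rewrite {2}QE /D /Q /B -big_split mulr_sumr -sumrB; apply: eq_bigr => x _ /=.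
  rewrite -big_split mulr_sumr -sumrB; apply: eq_bigr => y _ /=.
  by ring.
have LE : \sum_(x <- A) g x * (pi x * g x - \sum_(y <- A) c x y * g y) =
    \sum_(x <- A) pi x * g x ^+ 2 - B.
  rewrite /B -sumrB; apply: eq_bigr => x _; rewrite mulrBr mulr_sumr.
  congr (_ - _); first by ring.
  by apply: eq_bigr => y _; ring.
have KE : \sum_(x <- A) killing x * g x ^+ 2 = \sum_(x <- A) pi x * g x ^+ 2 - Q.
  by rewrite /Q -sumrB; apply: eq_bigr => x _; rewrite mulrBl mulr_suml.
rewrite LE KE DE; lra.
Qed.

(** Pair the Poisson equation with the Green function itself and drop the nonpositive truncation
    term. *)
Lemma green_energy N :
  (\sum_(x <- A) \sum_(y <- A) c x y * (green N x - green N y) ^+ 2) / 2 +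
  \sum_(x <- A) killing x * green N x ^+ 2 <= pi o * green N o.
Proof.
rewrite -dirichlet_form.
apply: (@le_trans _ _ (\sum_(x <- A) green N x * (pi x * (x == o)%:R))).
  apply: ler_sum => x _; rewrite ler_wpM2l ?green_ge0 // green_poisson.
  by rewrite gerBl mulr_ge0 ?hit_prob_ge0 // ltW.
rewrite (bigD1_seq o) //= eqxx big1 => [|x /negPf ->]; last by rewrite !mulr0.
by rewrite addr0 mulr1 mulrC.
Qed.

Lemma green_edge N x y : x \in A -> y \in A ->
  c x y * (green N x - green N y) ^+ 2 <= pi o * green N o.
Proof.
move=> xA yA; apply: le_trans (green_energy N).
have [->|xy] := eqVneq x y.
  rewrite subrr expr0n mulr0 addr_ge0 //.
    by rewrite divr_ge0 // sumr_ge0 // => z _; rewrite sumr_ge0 // => t _;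
       rewrite mulr_ge0 // sqr_ge0.
  by rewrite sumr_ge0 // => z _; rewrite mulr_ge0 ?sqr_ge0 // killing_ge0.
set F := fun x y => c x y * (green N x - green N y) ^+ 2.
have F0 z t : 0 <= F z t by rewrite mulr_ge0 // sqr_ge0.
have FS z t : F z t = F t z by rewrite /F c_sym -sqrrN opprB.
have K0 : 0 <= \sum_(x <- A) killing x * green N x ^+ 2.
  by rewrite sumr_ge0 // => z _; rewrite mulr_ge0 ?sqr_ge0 // killing_ge0.
(* The edge occurs in both orientations, which compensates the factor 1/2 of the energy. *)
have : F x y + F y x <= \sum_(x <- A) \sum_(y <- A) F x y.
  apply: le_trans (ler_term_sum2 _ A_uniq xA yA xy).
    by apply: lerD; apply: ler_term_sum.
  by move=> z; rewrite sumr_ge0.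
by rewrite -(FS x y) -/F -[c x y * _]/(F x y); lra.
Qed.

Lemma green_kill N x : x \in A -> killing x * green N x ^+ 2 <= pi o * green N o.
Proof.
move=> xA; apply: le_trans (green_energy N).
apply: le_trans (ler_term_sum (F := fun x => killing x * green N x ^+ 2) _ xA) _.
  by move=> y; rewrite mulr_ge0 ?sqr_ge0 // killing_ge0.
rewrite lerDr divr_ge0 // sumr_ge0 // => y _; rewrite sumr_ge0 // => z _.
by rewrite mulr_ge0 // sqr_ge0.
Qed.

(** Maximum principle: away from [o] the value is a sub-average of values at the previous
    truncation. *)
Lemma green_max N x : green N x <= green N o.
Proof.
elim: N x => [|N IHN] x.
  by rewrite /green !big_nat1 /= eqxx lern1 leq_b1.
have [->//|xo] := eqVneq x o.
apply: le_trans (green_leS _ _); rewrite greenS (negPf xo) add0r.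
apply: (@le_trans _ _ (\sum_(y <- A) c x y / pi x * green N o)).
  by apply: ler_sum => y _; rewrite ler_wpM2l // divr_ge0 // ltW.
rewrite -!big_distrl /= -[leRHS]mul1r ler_wpM2r ?green_ge0 //.
by rewrite ler_pdivrMr // mul1r.
Qed.

(* [mass n / pi o] is the probability of surviving up to time n, by reversibility. *)
Let mass n := \sum_(x <- A) pi x * hit_prob n x.

(** The initial mass [pi o] is either killed by time [N] or still present. The killed part is at
    most the total killing times the maximum of the Green function; the remaining part, as mass
    decreases, is at most its average over times 0 to [N]. *)
Lemma green_lower N :
  pi o <= (\sum_(x <- A) killing x + (\sum_(x <- A) pi x) / N.+1%:R) * green N o.
Proof.
have massS n : mass n.+1 = mass n - \sum_(x <- A) killing x * hit_prob n x.
  have -> : mass n.+1 = \sum_(x <- A) \sum_(y <- A) c x y * hit_prob n y.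
    apply: eq_bigr => x _; rewrite /= mulr_sumr; apply: eq_bigr => y _.
    by field; rewrite gt_eqF.
  rewrite /mass -sumrB exchange_big; apply: eq_bigr => x _ /=.
  rewrite /killing mulrBl opprB addrC subrK -mulr_suml.
  by under eq_bigr => y _ do rewrite c_sym.
have massE n : mass n = pi o - \sum_(0 <= k < n) \sum_(x <- A) killing x * hit_prob k x.
  elim: n => [|n IHn]; last by rewrite massS IHn big_nat_recr //= opprD addrA.
  rewrite big_geq // subr0 /mass (bigD1_seq o) //= eqxx big1 => [|x /negPf ->].
    by rewrite addr0 mulr1.
  by rewrite mulr0.
have mass_le n m : (n <= m)%N -> mass m <= mass n.
  elim: m => [|m IHm]; first by rewrite leqn0 => /eqP ->.
  rewrite leq_eqVlt => /orP[/eqP ->//|/IHm]; apply: le_trans.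
  rewrite massS gerBl sumr_ge0 // => x _.
  by rewrite mulr_ge0 ?killing_ge0 ?hit_prob_ge0.
have N0 : 0 < N.+1%:R :> R by rewrite ltr0n.
rewrite -[leLHS](subrK (\sum_(0 <= k < N.+1) \sum_(x <- A) killing x * hit_prob k x)).
rewrite -massE addrC mulrDl; apply: lerD.
  rewrite exchange_big /= mulr_suml; apply: ler_sum => x _.
  by rewrite -mulr_sumr ler_wpM2l ?killing_ge0 // green_max.
rewrite mulrAC ler_pdivlMr //.
apply: (@le_trans _ _ (\sum_(0 <= k < N.+1) mass k)).
  rewrite -[N.+1 in leLHS]subn0 mulr_natr -sumr_const_nat.
  rewrite big_nat_cond [leRHS]big_nat_cond; apply: ler_sum => k /andP[/andP[_ kN] _].
  exact: mass_le (ltnW kN).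
rewrite exchange_big mulr_suml; apply: ler_sum => x _.
by rewrite -mulr_sumr ler_wpM2l ?green_max // ltW.
Qed.

End KilledGreen.

(** * Balls of Cayley graphs *)

Section CayleyDistance.
Variables (G : groupType) (S : seq G).
Hypothesis S_gen : symmetric_gen_set S.

Lemma symmetric_gen_setV s : s \in S -> (s^-1)%g \in S.
Proof. by case: S_gen => _ _ + _; apply. Qed.

Lemma word_of_ex v : exists n, `[< word_of S n v >].
Proof.
have [_ _ _ /(_ v)[w [wS vw]]] := S_gen.
by exists (size w); apply/asboolP; exists w.
Qed.

Definition dist (v : G) : nat := ex_minn (word_of_ex v).

Lemma is_distP v n : is_dist S v n <-> n = dist v.
Proof.
rewrite /dist; case: ex_minnP => m /asboolP vm m_min; split.
  case=> vn n_min; apply/eqP; rewrite eqn_leq; apply/andP; split.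
    by rewrite leqNgt; apply/negP => /n_min.
  exact/m_min/asboolP.
move=> ->; split=> // k km /asboolP/m_min.
by rewrite leqNgt km.
Qed.

Lemma dist_le n v : word_of S n v -> (dist v <= n)%N.
Proof. by move=> vn; rewrite /dist; case: ex_minnP => m _; apply; apply/asboolP. Qed.

Lemma dist_word v : word_of S (dist v) v.
Proof. by have /is_distP[] : dist v = dist v by []. Qed.

Lemma dist1 : dist 1%g = 0%N.
Proof. by apply/eqP; rewrite -leqn0; apply: dist_le; exists [::]; rewrite big_nil. Qed.

Lemma dist_eq0 v : dist v = 0%N -> v = 1%g.
Proof. by have [w [<- _ ->]] := dist_word v => /size0nil ->; rewrite big_nil. Qed.

Lemma dist_mul v s : s \in S -> (dist (v * s)%g <= (dist v).+1)%N.
Proof.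
move=> sS; have [w [wn wS vw]] := dist_word v; apply: dist_le.
exists (rcons w s); rewrite size_rcons wn all_rcons wS andbT; split=> //.
by rewrite -cats1 big_cat big_seq1 -vw.
Qed.

Lemma dist_mulV v s : s \in S -> (dist v <= (dist (v * s)%g).+1)%N.
Proof.
by move=> /symmetric_gen_setV/(dist_mul (v * s)%g); rewrite mulgK.
Qed.

Lemma dist_pred v n : dist v = n.+1 ->
  exists u s, [/\ s \in S, v = (u * s)%g & dist u = n].
Proof.
move=> vn; have [w [wn wS vw]] := dist_word v.
move: wn; rewrite vn; case/lastP: w wS vw => [//|w s].
rewrite all_rcons size_rcons => /andP[sS wS] vw [wn].
have vE : v = ((\prod_(x <- w) x) * s)%g.
  by rewrite vw -cats1 big_cat big_seq1.
exists (\prod_(x <- w) x)%g, s; split=> //; apply/eqP; rewrite eqn_leq.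
apply/andP; split; first by apply: dist_le; exists w.
by rewrite -ltnS -vn vE dist_mul.
Qed.

Lemma closerP v s : closer S v s <-> dist v = (dist (v * s)%g).+1.
Proof.
split=> [[n [/is_distP <- /is_distP <-]] //|vs].
by exists (dist (v * s)%g); split; apply/is_distP.
Qed.

(** * Balls and their linear growth *)

Fixpoint ball (n : nat) : seq G :=
  if n is n'.+1 then undup (ball n' ++ [seq (x * s)%g | x <- ball n', s <- S])
  else [:: 1%g].

Lemma ball_uniq n : uniq (ball n).
Proof. by case: n => [//|n]; apply: undup_uniq. Qed.

Lemma mem_ball n v : (v \in ball n) = (dist v <= n)%N.
Proof.
elim: n v => [|n IHn] v.
  by rewrite mem_seq1 leqn0; apply/eqP/eqP => [->|/dist_eq0 //]; apply: dist1.
rewrite /= mem_undup mem_cat IHn; apply/orP/idP => [[/leqW //|]|].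
  case/allpairsP => -[x s] /= [xn sS ->].
  by apply: leq_trans (dist_mul _ sS) _; rewrite ltnS -IHn.
rewrite leq_eqVlt ltnS => /orP[/eqP/dist_pred[u [s [sS -> un]]]|vn]; [right|by left].
by apply/allpairsP; exists (u, s); rewrite IHn un.
Qed.

(** No sphere is empty: otherwise [G] would lie in a finite ball, which cannot contain all the
    distinct powers of [g]. So each radius adds an element. *)
Lemma ball_size_ge n : virtually_Z G -> (n < size (ball n))%N.
Proof.
case=> g [g_inf _].
have sphere m : exists v, dist v = m.+1.
  apply: contrapT => no_v.
  have all_le v : (dist v <= m)%N.
    elim: {v}(dist v) {-2}v (erefl (dist v)) => [v -> //|k IHk v vk].
    have [u [s [sS vE /IHk um]]] := dist_pred vk.
    move: um; rewrite leq_eqVlt => /orP[/eqP um|um].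
      have := dist_mul u sS; rewrite -vE um leq_eqVlt => /orP[/eqP vm|//].
      by case: no_v; exists v.
    by apply: leq_trans um; rewrite vE dist_mul.
  have g_inj : injective (fun k : nat => (g ^+ k)%g).
    have lt_neq i j : (i < j)%N -> (g ^+ i)%g <> (g ^+ j)%g.
      move=> ij gij; have := g_inf (j - i)%N; rewrite subn_gt0 => /(_ ij)/eqP.
      by apply; rewrite (expgnFr _ (ltnW ij)) gij mulgV.
    move=> i j /= gij; have [ij|ji|//] := ltngtP i j.
      by case: (lt_neq _ _ ij).
    by case: (lt_neq _ _ ji).
  have := @uniq_leq_size _ [seq (g ^+ k)%g | k <- iota 0 (size (ball m)).+1] (ball m).
  rewrite map_inj_uniq // iota_uniq size_map size_iota ltnn => H.
  by suff: false by []; apply: H => // x _; rewrite mem_ball.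
elim: n => [//|n IHn]; have [v vn] := sphere n.
apply: leq_ltn_trans IHn _.
have : uniq (v :: ball n) by rewrite /= ball_uniq mem_ball vn ltnn.
move/(@uniq_leq_size _ _ (ball n.+1)); apply.
by move=> x; rewrite in_cons !mem_ball => /orP[/eqP ->|/leqW //]; rewrite vn.
Qed.

(** Every element is a signed power of [g] times one of finitely many representatives, and right
    multiplication by a generator changes the exponent by a bounded amount. *)
Lemma ball_size_le : virtually_Z G ->
  exists C, forall n, (size (ball n) <= C * n.+1)%N.
Proof.
case=> g [_ [reps repsP]].
pose pw (e : bool) k := (if e then (g ^+ k)^-1 else g ^+ k)%g.
(* Inversion puts the power of [g] on the left, so that a generator multiplied on the right meets
   the representative. *)
pose Q := [seq (r^-1)%g | r <- reps].
have pwM e k e' k' : exists e'' i, (i <= k + k')%N /\ (pw e k * pw e' k')%g = pw e'' i.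
  have gg i j : (g ^+ i * g ^+ j = g ^+ j * g ^+ i)%g by rewrite -!expgnDr addnC.
  have gV i j : (g ^+ i * (g ^+ j)^-1 = (g ^+ j)^-1 * g ^+ i)%g.
    exact/commuteV/gg.
  have sub i j : exists e'' l, (l <= i + j)%N /\ (g ^+ i * (g ^+ j)^-1)%g = pw e'' l.
    have [ij|/ltnW ij] := leqP j i.
      exists false, (i - j)%N; split; first lia.
      by rewrite /pw expgnFr.
    exists true, (j - i)%N; split; first lia.
    by rewrite /pw expgnFr // invgF.
  case: e e' => [] [] /=.
  - by exists true, (k' + k)%N; rewrite /pw expgnDr invMg addnC.
  - by rewrite /pw -gV addnC; apply: sub.
  - exact: sub.
  - by exists false, (k + k')%N; rewrite /pw expgnDr.
have QP x : exists k, exists e q, q \in Q /\ x = (pw e k * q)%g.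
  have [r rr [n [] xE]] := repsP (x^-1)%g; exists n; [exists true|exists false];
    by exists (r^-1)%g; rewrite map_f //; split=> //; apply: invg_inj; rewrite xE invMg !invgK.
have [f fP] := boolp.choice QP.
pose K := \max_(q <- Q) \max_(s <- S) f (q * s)%g.
have KP q s : q \in Q -> s \in S -> (f (q * s)%g <= K)%N.
  move=> qQ sS; apply: leq_trans (leq_bigmax_seq _ qQ isT).
  exact: (@leq_bigmax_seq _ S xpredT (fun s => f (q * s)%g) s).
have distP n v : dist v = n ->
    exists k e q, [/\ (k <= f 1%g + K * n)%N, q \in Q & v = (pw e k * q)%g].
  elim: n v => [|n IHn] v; first move=> /dist_eq0 ->.
    by have [e [q [qQ q1]]] := fP 1%g; exists (f 1%g), e, q; rewrite muln0 addn0.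
  move=> /dist_pred[u [s [sS -> /IHn[k [e [q [kn qQ ->]]]]]]].
  have [e' [q' [q'Q qsE]]] := fP (q * s)%g.
  have [e'' [i [ik pE]]] := pwM e k e' (f (q * s)%g).
  exists i, e'', q'; split=> //; last by rewrite -mulgA qsE mulgA pE.
  by have := KP _ _ qQ sS; lia.
(* Two signs, exponents up to [f 1%g + K * n], and [size Q] representatives. *)
exists (2 * (f 1%g + K).+1 * size Q)%N => n.
pose t := [seq (x * q)%g | x <- [seq pw e k | e <- [:: true; false],
                                 k <- iota 0 (f 1%g + K * n).+1], q <- Q].
have : {subset ball n <= t}.
  move=> v; rewrite mem_ball => vn.
  have [k [e [q [kn qQ ->]]]] := distP _ _ (erefl (dist v)).
  apply: allpairs_f => //; apply: allpairs_f; first by case: e.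
  by rewrite mem_iota add0n ltnS (leq_trans kn) // leq_add2l leq_mul2l vn orbT.
move/(uniq_leq_size (ball_uniq n)) => /leq_trans; apply.
rewrite !size_allpairs size_iota /= -!mulnA leq_mul2l /= [(size Q * _)%N]mulnC mulnA.
by rewrite leq_mul2r; apply/orP; right; nia.
Qed.

End CayleyDistance.

(** * Homesick walk as a reversible walk *)

Section HomesickConductances.
Variables (R : realType) (G : groupType) (S : seq G).
Hypothesis S_gen : symmetric_gen_set S.
Hypothesis S_neq0 : (0 < size S)%N.
Variable lambda : R.
Hypothesis lambda_gt0 : 0 < lambda.

Local Notation dist := (dist S_gen).
Local Notation ball := (ball S).
Local Notation weight := (@walk_weight R G S lambda).
Local Notation step := (@walk_step G S).

Definition conductance (x y : G) : R :=
  if (x^-1 * y)%g \in S then lambda ^- minn (dist x) (dist y) else 0.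

Definition vertex_mass (x : G) : R := \sum_(s <- S) conductance x (x * s)%g.

Lemma conductance_sym x y : conductance x y = conductance y x.
Proof.
rewrite /conductance minnC -[(y^-1 * x)%g]invgK invMg invgK.
have -> // : ((x^-1 * y)^-1 \in S)%g = ((x^-1 * y)%g \in S).
by apply/idP/idP => /(symmetric_gen_setV S_gen); rewrite ?invgK.
Qed.

Lemma conductance_ge0 x y : 0 <= conductance x y.
Proof. by rewrite /conductance; case: ifP => // _; rewrite invr_ge0 exprn_ge0 // ltW. Qed.

Lemma conductance_mul x s : s \in S ->
  conductance x (x * s)%g = lambda ^- minn (dist x) (dist (x * s)%g).
Proof. by move=> sS; rewrite /conductance mulKg sS. Qed.

Lemma vertex_mass_gt0 x : 0 < vertex_mass x.
Proof.
have sS : nth 1%g S 0 \in S by exact: mem_nth.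
apply: lt_le_trans (ler_term_sum (F := fun s => conductance x (x * s)%g) _ sS).
  by rewrite conductance_mul // invr_gt0 exprn_gt0.
by move=> s; apply: conductance_ge0.
Qed.

Lemma vertex_mass1 : vertex_mass 1%g = (size S)%:R.
Proof.
rewrite /vertex_mass -sum1_size natr_sum big_seq [RHS]big_seq.
apply: eq_bigr => s sS; rewrite conductance_mul // dist1 min0n.
by rewrite expr0 invr1.
Qed.

(** Translates between sums over vertices, as in killed walks, and sums over generators, as in the
    homesick walk. *)
Lemma sum_conductance (A : seq G) (F : G -> R) x : uniq A ->
  \sum_(y <- A) conductance x y * F y =
  \sum_(s <- S | (x * s)%g \in A) conductance x (x * s)%g * F (x * s)%g.
Proof.
move=> A_uniq.
transitivity (\sum_(y <- A | (x^-1 * y)%g \in S) conductance x y * F y).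
  rewrite [RHS]big_mkcond; apply: eq_bigr => y _.
  by rewrite /conductance; case: ifP => // _; rewrite mul0r.
rewrite -big_filter -[RHS]big_filter -(big_map (fun s => x * s)%g xpredT
  (fun y => conductance x y * F y)).
apply: perm_big; apply: uniq_perm; first exact: filter_uniq.
  rewrite map_inj_uniq ?filter_uniq //; first by case: S_gen.
  exact: mulgI.
move=> y; rewrite mem_filter; apply/andP/mapP => [[yS yA]|[s]].
  by exists (x^-1 * y)%g; rewrite ?mem_filter ?mulKVg ?yA.
by rewrite mem_filter => /andP[xsA sS] ->; rewrite mulKg.
Qed.

(** The minimum of the two distances is [dist x] except on an edge towards the identity, where it is
    one less. The prefactor depends on [x] alone and cancels in the transition probabilities. *)
Lemma hs_weightE x s : s \in S ->
  hs_weight S lambda x s = lambda ^+ dist x * conductance x (x * s)%g.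
Proof.
move=> sS; rewrite conductance_mul // /hs_weight.
have l0 : lambda != 0 by rewrite gt_eqF.
case: asboolP => [/(closerP S_gen) ->|far].
  by rewrite /minn ltnNge leqnSn /= exprS mulfK // expf_neq0.
rewrite (minn_idPl _) ?divff ?expf_neq0 //.
have := dist_mulV S_gen x sS; rewrite leq_eqVlt ltnS => /orP[/eqP xs|//].
by case: far; apply/(closerP S_gen).
Qed.

Lemma walk_weightE x (i : 'I_(size S)) :
  weight x i = conductance x (step x i) / vertex_mass x.
Proof.
rewrite /walk_weight /hs_prob /walk_step.
have -> : \sum_(j < size S) hs_weight S lambda x (nth 1%g S j) = lambda ^+ dist x * vertex_mass x.
  rewrite -(big_mkord xpredT (fun j => hs_weight S lambda x (nth 1%g S j))) -(big_nth 1%g xpredT).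
  rewrite mulr_sumr big_seq [RHS]big_seq; apply: eq_bigr => s sS.
  exact: hs_weightE.
rewrite hs_weightE ?mem_nth //; field.
by rewrite expf_neq0 !gt_eqF // vertex_mass_gt0.
Qed.

Lemma walk_weight_ge0 x i : 0 <= weight x i.
Proof.
by rewrite walk_weightE divr_ge0 ?conductance_ge0 // ltW // vertex_mass_gt0.
Qed.

Lemma sum_walk_step (F : G -> R) x :
  \sum_i weight x i * F (step x i) =
  \sum_(s <- S) conductance x (x * s)%g / vertex_mass x * F (x * s)%g.
Proof.
rewrite (big_nth 1%g) big_mkord; apply: eq_bigr => i _.
by rewrite walk_weightE.
Qed.

Lemma walk_weight_sum x : \sum_i weight x i = 1.
Proof.
have := sum_walk_step (fun=> 1) x; under eq_bigr do rewrite mulr1.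
move=> ->; under eq_bigr do rewrite mulr1.
by rewrite -mulr_suml divff // gt_eqF // vertex_mass_gt0.
Qed.

Lemma sum_conductance_le (A : seq G) x : uniq A ->
  \sum_(y <- A) conductance x y <= vertex_mass x.
Proof.
move=> A_uniq; have := sum_conductance (fun=> 1) x A_uniq.
under eq_bigr do rewrite mulr1.
move=> ->; rewrite big_mkcond; apply: ler_sum => s _; rewrite mulr1.
by case: ifP => // _; apply: conductance_ge0.
Qed.

(** * Green functions of the killed homesick walk *)

Local Notation killed_green A := (green A conductance vertex_mass 1%g).
Local Notation killed_hit A := (hit_prob A conductance vertex_mass 1%g).

(** The bridge from trajectory expectations to potential theory: surviving means that all states
    after the start are in [A]. *)
Lemma killed_hitE (A : seq G) n x : uniq A ->
  expect weight step n x (fun l => ((last x l == 1%g) && all (mem A) l)%:R) =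
  killed_hit A n x.
Proof.
move=> A_uniq; elim: n x => [|n IHn] x; first by rewrite /expect /= andbT.
rewrite expectS /=.
transitivity (\sum_i weight x i * ((step x i \in A)%:R * killed_hit A n (step x i))).
  apply: eq_bigr => i _; congr (_ * _); rewrite -IHn -expectZ.
  by apply: eq_expect => l /=; rewrite -natrM mulnb andbCA.
rewrite (sum_walk_step (fun y => (y \in A)%:R * killed_hit A n y)).
transitivity ((\sum_(y <- A) conductance x y * killed_hit A n y) / vertex_mass x).
  rewrite sum_conductance // [X in X / _]big_mkcond mulr_suml; apply: eq_bigr => s _.
  by case: ifP => _; rewrite ?mul1r ?mul0r ?mulr0 // mulrAC.
by rewrite mulr_suml; apply: eq_bigr => y _; rewrite mulrAC.
Qed.

Lemma killingE (A : seq G) x : uniq A ->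
  killing A conductance vertex_mass x =
  \sum_(s <- S | (x * s)%g \notin A) conductance x (x * s)%g.
Proof.
move=> A_uniq; rewrite /killing.
have -> : \sum_(y <- A) conductance x y = \sum_(y <- A) conductance x y * 1.
  by under [RHS]eq_bigr do rewrite mulr1.
rewrite sum_conductance // /vertex_mass (bigID (fun s => (x * s)%g \in A)) /=.
under [X in _ - X]eq_bigr do rewrite mulr1.
by rewrite addrAC subrr add0r.
Qed.

(* If the potential at the origin were too large, then by the energy bound the
   potential drop across each of the r.+1 edges of a geodesic from 1 to v
   would be less than the average drop. *)
Lemma green_avoid_le M N v r : 1 <= lambda -> dist v = r.+1 -> (r < M)%N ->
  killed_green [seq x <- ball M | x != v] N 1%g <=
  (size S)%:R * r.+1%:R ^+ 2 * lambda ^+ r.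
Proof.
move=> lambda1 vr rM; set A := [seq x <- _ | _].
have A_uniq : uniq A by rewrite filter_uniq // ball_uniq.
have Aball x : (dist x <= r)%N -> x \in A.
  move=> xr; rewrite mem_filter (mem_ball S_gen) (leq_trans xr (ltnW rM)) andbT.
  by apply: contraTneq xr => ->; rewrite vr ltnn.
have oA : 1%g \in A by apply: Aball; rewrite dist1.
have c_le x := sum_conductance_le x A_uniq.
rewrite leNgt; apply/negP; set g := killed_green A N; set n := r.+1%:R : R.
move=> g_big.
have n0 : 0 < n by rewrite ltr0n.
have S0 : 0 < (size S)%:R :> R by rewrite ltr0n.
have lr0 : 0 < lambda ^+ r by rewrite exprn_gt0.
have g0 : 0 < g 1%g.
  by apply: le_lt_trans g_big; rewrite !mulr_ge0 ?sqr_ge0 // ltW.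
set D := g 1%g / n; have D0 : 0 < D by rewrite divr_gt0.
(* A drop of at least [D] across conductance at least lambda^-r would cost more energy than [g_big]
   leaves available. *)
have lt_D c d : lambda ^- r <= c -> c * d ^+ 2 <= vertex_mass 1%g * g 1%g -> d < D.
  move=> lc; rewrite vertex_mass1 => cd; rewrite ltNge; apply/negP => Dd.
  have : lambda ^- r * D ^+ 2 <= (size S)%:R * g 1%g.
    apply: le_trans cd; apply: ler_pM => //; [by rewrite invr_ge0 ltW|exact: sqr_ge0|].
    by apply: lerXn2r => //; rewrite nnegrE; [exact: ltW|exact: le_trans (ltW D0) Dd].
  rewrite ler_pdivrMl // /D expr_div_n ler_pdivrMr ?exprn_gt0 // expr2 => H.
  have : g 1%g * g 1%g <= g 1%g * ((size S)%:R * n ^+ 2 * lambda ^+ r).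
    by apply: le_trans H _; rewrite le_eqVlt; apply/orP; left; apply/eqP; ring.
  by rewrite ler_pM2l // leNgt g_big.
have cond_ge i x s : s \in S -> dist x = i -> (i <= r)%N ->
    lambda ^- r <= conductance x (x * s)%g.
  move=> sS xi ir; rewrite conductance_mul // lef_pV2 ?posrE ?exprn_gt0 //.
  by rewrite ler_weXn2l // xi (leq_trans (geq_minl _ _)).
have drop i x : dist x = i -> (i <= r)%N -> g 1%g - g x <= i%:R * D.
  elim: i x => [|i IHi] x; first by move=> /dist_eq0 -> _; rewrite subrr mul0r.
  move=> xi ir; have [u [s [sS xE ui]]] := dist_pred xi.
  have ui_r : (dist u <= r)%N by rewrite ui ltnW.
  have H := green_edge A_uniq oA conductance_sym conductance_ge0 vertex_mass_gt0 c_le N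
    (Aball u ui_r) (Aball x _).
  have {H} := H ltac:(by rewrite xi); rewrite -/g => H.
  have := lt_D _ _ (cond_ge i u s sS ui (ltnW ir)); rewrite -xE => /(_ _ H).
  have := IHi u ui (ltnW ir); rewrite -[i.+1]addn1 natrD; lra.
have [u [s [sS vE ur]]] := dist_pred vr.
have uA : u \in A by apply: Aball; rewrite ur.
(* The last edge of the geodesic leads to the excluded vertex [v], so it is seen through the killing
   at [u]. *)
have H := green_kill A_uniq oA conductance_sym conductance_ge0 vertex_mass_gt0 c_le N uA.
have : g u < D.
  apply: lt_D H; apply: le_trans (cond_ge r u s sS ur (leqnn r)) _.
  rewrite killingE // big_mkcond /=.
  have := ler_term_sum (F := fun s => if (u * s)%g \notin A then
     conductance u (u * s)%g else 0) _ sS.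
  rewrite -vE mem_filter eqxx /=; apply.
  by move=> t; case: ifP => // _; apply: conductance_ge0.
(* The drops up to [u] total at most r D, and the last is strictly below D, yet they add up to g(1)
   = (r + 1) D. *)
have := drop r u ur (leqnn r).
have : g 1%g = r%:R * D + D by rewrite -[g _](divfK (lt0r_neq0 n0)) -/D /n -[r.+1]addn1 natrD; ring.
lra.
Qed.

(** In [green_lower], the total killing is at most [K], and [N] is taken so large that the
    surviving-mass term is at most [K] too; this doubling is the 2 in the bound. *)
Lemma green_ball_ge r : exists N,
  lambda ^+ r / (2 * (size (ball r))%:R) <= killed_green (ball r) N 1%g.
Proof.
have A_uniq := ball_uniq S r.
have oA : 1%g \in ball r by rewrite (mem_ball S_gen) dist1.
have c_le x := sum_conductance_le x A_uniq.
have lr0 : 0 < lambda ^+ r by rewrite exprn_gt0.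
have b0 : 0 < (size (ball r))%:R :> R by rewrite ltr0n; case: (ball r) oA.
have S0 : 0 < (size S)%:R :> R by rewrite ltr0n.
set b : R := (size (ball r))%:R in b0 *; set d : R := (size S)%:R in S0 *.
set K := b * (d * lambda ^- r).
have K0 : 0 < K by rewrite !mulr_gt0 // invr_gt0.
have killing_le x : x \in ball r ->
    killing (ball r) conductance vertex_mass x <= d * lambda ^- r.
  rewrite (mem_ball S_gen) => xr; rewrite killingE //.
  rewrite /d -sum1_size natr_sum mulr_suml big_mkcond big_seq [leRHS]big_seq.
  apply: ler_sum => s sS; rewrite mul1r; case: ifPn => [|_]; last first.
    by rewrite invr_ge0 ltW.
  rewrite (mem_ball S_gen) -ltnNge => xs; rewrite conductance_mul //.
  have := dist_mul S_gen x sS => xs'.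
  (* An edge leaving the ball joins distance r to distance r + 1. *)
  by have -> : minn (dist x) (dist (x * s)%g) = r by lia.
set P := \sum_(x <- ball r) vertex_mass x.
have P0 : 0 <= P / K.
  by rewrite divr_ge0 ?(ltW K0) // sumr_ge0 // => x _; rewrite ltW // vertex_mass_gt0.
pose N := Num.bound (P / K); exists N.
have PN : P / N.+1%:R <= K.
  rewrite ler_pdivrMr ?ltr0n // mulrC -ler_pdivrMr //.
  by apply: ltW; apply: lt_trans (archi_boundP P0) _; rewrite ltr_nat.
have := green_lower A_uniq oA conductance_sym conductance_ge0 vertex_mass_gt0 c_le N.
rewrite vertex_mass1 -/P -/d; set g := killed_green _ _ _ => H.
have g0 : 0 <= g by apply: green_ge0 => //; [apply: conductance_ge0|apply: vertex_mass_gt0].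
have {}H : d <= (K + K) * g.
  apply: le_trans H _; apply: ler_wpM2r => //; apply: lerD => //.
  rewrite /K /b -sum1_size natr_sum mulr_suml big_seq [leRHS]big_seq.
  by apply: ler_sum => x xA; rewrite mul1r killing_le.
rewrite ler_pdivrMr ?mulr_gt0 // -(ler_pM2l S0).
have -> : d * (g * (2 * b)) = lambda ^+ r * ((K + K) * g).
  by rewrite /K; field; rewrite gt_eqF.
by rewrite mulrC ler_pM2l.
Qed.

End HomesickConductances.

(** * Mean number of returns of the lamplighter walk *)

Section LampGreenEstimates.
Variables (R : realType) (G : groupType) (S : seq G) (H : finGroupType).
Hypothesis S_gen : symmetric_gen_set S.
Hypothesis G_vZ : virtually_Z G.
Hypothesis S_neq0 : (0 < size S)%N.
Variable lambda : R.
Hypothesis lambda_gt0 : 0 < lambda.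

Local Notation dist := (dist S_gen).
Local Notation ball := (ball S).
Local Notation bsize r := (size (ball r)).
Local Notation h := (#|H|%:R : R).
Local Notation weight := (@walk_weight R G S lambda).
Local Notation step := (@walk_step G S).
Local Notation killed_green A :=
  (green A (conductance S_gen lambda) (vertex_mass S_gen lambda) 1%g).

Definition lamp_mean (N : nat) : R :=
  mean_returns (@lamp_weight R G S H lambda) (@lstep G S H) (@is_id G H) N
    (lstate_id G H).

Lemma card_group_ge1 : 1 <= h.
Proof. by rewrite ler1n; apply/card_gt0P; exists 1%g. Qed.

Let h_gt0 : 0 < h := lt_le_trans ltr01 card_group_ge1.
Let weight_ge0 := walk_weight_ge0 S_gen S_neq0 lambda_gt0.

Lemma lamp_weight_ge0 st c : 0 <= @lamp_weight R G S H lambda st c.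
Proof. by rewrite divr_ge0 ?sqr_ge0 // -/(weight _ _) weight_ge0. Qed.

Lemma lamp_weight_sum st : \sum_c @lamp_weight R G S H lambda st c = 1.
Proof.
rewrite sum_triple -(walk_weight_sum S_gen S_neq0 lambda_gt0 st.2).
apply: eq_bigr => i _; rewrite /lamp_weight /= !sum_cst -/(weight _ _); field.
exact: lt0r_neq0.
Qed.

Lemma lamp_meanE N : lamp_mean N = \sum_(1 <= n < N.+1)
  expect weight step n 1%g
    (fun l => (last 1%g l == 1%g)%:R * h ^- size (undup (1%g :: l))).
Proof.
have S1 : 1%g \notin S by case: S_gen.
rewrite /lamp_mean mean_returnsE; last exact: lamp_weight_sum.
rewrite !big_add1 /=; apply: eq_bigr => n _.
rewrite lamp_return_prob //; apply: eq_expect => l.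
rewrite [lamps_off _ _](_ : _ = true) ?mulr1 //.
exact/asboolP.
Qed.

(** Keep only trajectories inside the ball, whose range has at most [bsize r] sites. The -1 removes
    time 0, which is not a return. *)
Lemma lamp_mean_ge r N :
  h ^- bsize r * (killed_green (ball r) N 1%g - 1) <= lamp_mean N.
Proof.
have -> : killed_green (ball r) N 1%g - 1 = \sum_(1 <= n < N.+1)
    hit_prob (ball r) (conductance S_gen lambda) (vertex_mass S_gen lambda) 1%g n 1%g.
  by rewrite /green big_nat_recl //= eqxx addrAC subrr add0r big_add1.
rewrite lamp_meanE mulr_sumr; apply: ler_sum => n _.
rewrite -(killed_hitE S_gen S_neq0 lambda_gt0 n 1%g (ball_uniq S r)).
rewrite -expectZ; apply: ler_expect => [//|l _ _]; set k := size (undup _).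
case: eqP => _ /=; last by rewrite mulr0 mul0r.
rewrite mul1r; case: (boolP (all _ _)) => [/allP lr|_]; last first.
  by rewrite mulr0 invr_ge0 exprn_ge0 // ltW.
rewrite mulr1 lef_pV2 ?posrE ?exprn_gt0 // ler_weXn2l ?card_group_ge1 //.
apply: uniq_leq_size (undup_uniq _) _.
move=> x; rewrite mem_undup in_cons => /orP[/eqP ->|/lr //].
by rewrite (mem_ball S_gen) dist1.
Qed.

Lemma traj_ball M x l : is_traj step x l -> (dist x + size l <= M)%N ->
  all (mem (ball M)) l.
Proof.
elim: l x => [//|y l IHl] x /= [[i ->] tl]; rewrite addnS => xM.
have yd : (dist (step x i) <= (dist x).+1)%N by apply: dist_mul; apply: mem_nth.
apply/andP; split; last by apply: IHl tl _; lia.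
suff: step x i \in ball M by []; rewrite (mem_ball S_gen); lia.
Qed.

(* The summand for the least [r] such that [ball r.+1] is not contained in
   [1 :: l] already dominates the left-hand side. *)
Lemma range_weight_le N l : (size l <= N)%N ->
  h ^- size (undup (1%g :: l)) <=
  \sum_(0 <= r < N.+1) h ^- bsize r *
    \sum_(v <- ball r.+1 | dist v == r.+1) (v \notin 1%g :: l)%:R.
Proof.
move=> lN.
(* The range has at most N + 1 sites, fewer than the ball of radius N + 1. *)
have not_all : exists r, ~~ all (mem (1%g :: l)) (ball r).
  exists N.+1; apply/negP => /allP sub.
  have := uniq_leq_size (ball_uniq S N.+1) sub; rewrite leqNgt /= => /negP; apply.
  by apply: leq_trans (ball_size_ge S_gen N.+1 G_vZ); rewrite ltnS.
case: (ex_minnP not_all) => -[|r]; first by rewrite /= inE eqxx.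
move=> r_not r_min.
have r_all : {subset ball r <= 1%g :: l}.
  by apply/allP; apply: contraT => /r_min; rewrite ltnn.
have rN : (r <= N)%N.
  rewrite leqNgt; apply/negP => Nr.
  have sub : {subset ball N.+1 <= 1%g :: l}.
    by move=> v; rewrite (mem_ball S_gen) => vN; apply: r_all;
       rewrite (mem_ball S_gen) (leq_trans vN).
  have := uniq_leq_size (ball_uniq S N.+1) sub; rewrite leqNgt /= => /negP; apply.
  by apply: leq_trans (ball_size_ge S_gen N.+1 G_vZ); rewrite ltnS.
have in0 r' : 0 <= \sum_(v <- ball r'.+1 | dist v == r'.+1) (v \notin 1%g :: l)%:R :> R.
  by apply: sumr_ge0 => v _; rewrite ler0n.
have := @ler_term_sum R _ (index_iota 0 N.+1) (fun r => h ^- bsize r *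
    \sum_(v <- ball r.+1 | dist v == r.+1) (v \notin 1%g :: l)%:R) r.
rewrite mem_index_iota ltnS rN => /(_ _ isT) H1; apply: le_trans (H1 _); last first.
  by move=> r'; rewrite mulr_ge0 // invr_ge0 exprn_ge0 // ltW.
rewrite -[leLHS]mulr1; apply: ler_pM => //; first by rewrite invr_ge0 exprn_ge0 // ltW.
  rewrite lef_pV2 ?posrE ?exprn_gt0 // ler_weXn2l ?card_group_ge1 //.
  by apply: uniq_leq_size (ball_uniq _ _) _ => v /r_all; rewrite mem_undup.
have [v vr vl] := allPn r_not.
have vd : dist v = r.+1.
  apply/eqP; rewrite eqn_leq -(mem_ball S_gen) vr ltnNge -(mem_ball S_gen).
  by apply: contra vl; apply: r_all.
rewrite big_mkcond /=.
have := @ler_term_sum R _ (ball r.+1) (fun v => if dist v == r.+1 then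
  (v \notin 1%g :: l)%:R else 0) v; rewrite vd eqxx vl; apply=> // x.
by case: ifP => // _; rewrite ler0n.
Qed.

(** Insert [range_weight_le], exchange the sums, and bound by [green_avoid_le] the returns that
    avoid each of the at most [bsize r.+1] vertices [v]. *)
Lemma lamp_mean_le N : 1 <= lambda -> lamp_mean N <=
  \sum_(0 <= r < N.+1) h ^- bsize r *
    ((bsize r.+1)%:R * ((size S)%:R * r.+1%:R ^+ 2 * lambda ^+ r)).
Proof.
(* A finite substitute for the complement of [v]: [N] steps cannot leave this ball. Radius N + 1
   meets the condition r < M of [green_avoid_le] for every r <= N. *)
move=> lambda1; pose A v := [seq x <- ball N.+1 | x != v].
have A_uniq v : uniq (A v) by rewrite filter_uniq // ball_uniq.
have hit0 v n : 0 <= hit_prob (A v) (conductance S_gen lambda)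
    (vertex_mass S_gen lambda) 1%g n 1%g.
  by apply: hit_prob_ge0; [exact: conductance_ge0|exact: vertex_mass_gt0].
apply: (@le_trans _ _ (\sum_(1 <= n < N.+1) \sum_(0 <= r < N.+1)
    h ^- bsize r * \sum_(v <- ball r.+1 | dist v == r.+1)
      hit_prob (A v) (conductance S_gen lambda) (vertex_mass S_gen lambda) 1%g n 1%g)).
  rewrite lamp_meanE big_nat_cond [leRHS]big_nat_cond.
  apply: ler_sum => n /andP[/andP[_ nN] _].
  apply: (@le_trans _ _ (expect weight step n 1%g (fun l =>
    \sum_(0 <= r < N.+1) h ^- bsize r * \sum_(v <- ball r.+1 | dist v == r.+1)
      ((last 1%g l == 1%g) && all (mem (A v)) l)%:R))).
    apply: ler_expect => // l ln tl; rewrite ltnS in nN.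
    case: eqP => _; last first.
      rewrite mul0r; apply: sumr_ge0 => r _; rewrite mulr_ge0 //.
        by rewrite invr_ge0 exprn_ge0 // ltW.
      by rewrite big1.
    rewrite mul1r; apply: le_trans (@range_weight_le N l _) _; first by rewrite ln.
    apply: ler_sum => r _; rewrite ler_wpM2l ?invr_ge0 ?exprn_ge0 ?(ltW h_gt0) //.
    apply: ler_sum => v _; rewrite ler_nat; case: (boolP (v \in _)) => //=.
    rewrite in_cons negb_or => /andP[_ vl]; rewrite lt0b; apply/allP => x xl.
    suff: x \in A v by []; rewrite mem_filter (contraNneq _ vl) => [/=|<- //].
    have lb : all (mem (ball N.+1)) l by apply: traj_ball tl _; rewrite dist1 add0n ln leqW.
    exact: (allP lb).
  rewrite (expect_sum _ _ _ _ _ _ (fun r l => h ^- bsize r *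
     \sum_(v <- ball r.+1 | dist v == r.+1) ((last 1%g l == 1%g) && all (mem (A v)) l)%:R)).
  apply: ler_sum => r _; rewrite expectZ.
  rewrite (expect_sum _ _ _ _ _ _ (fun v l =>
    ((last 1%g l == 1%g) && all (mem (A v)) l)%:R)).
  rewrite ler_wpM2l ?invr_ge0 ?exprn_ge0 ?(ltW h_gt0) //.
  by apply: ler_sum => v _; rewrite killed_hitE.
rewrite exchange_big /= big_nat_cond [leRHS]big_nat_cond.
apply: ler_sum => r /andP[/andP[_ rN] _].
rewrite -mulr_sumr ler_wpM2l ?invr_ge0 ?exprn_ge0 ?(ltW h_gt0) //.
rewrite exchange_big -[X in X%:R * _]sum1_size natr_sum mulr_suml big_mkcond /=.
have d0 : 0 <= (size S)%:R * r.+1%:R ^+ 2 * lambda ^+ r.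
  by rewrite mulr_ge0 ?exprn_ge0 ?(ltW lambda_gt0) // mulr_ge0 ?sqr_ge0.
apply: ler_sum => v _; rewrite mul1r; case: eqP => [vr|//].
apply: le_trans (green_avoid_le S_neq0 lambda_gt0 N lambda1 vr rN).
by rewrite /green [leRHS]big_nat_recl // big_add1 lerDr ler0n.
Qed.

End LampGreenEstimates.

(** * The threshold *)

(** Bernoulli's inequality. It absorbs polynomial factors into an arbitrarily small change of the
    exponential rate. *)
Lemma natr_le_geom (R : realFieldType) (q : R) : 1 < q ->
  exists2 K : R, 0 < K & forall r : nat, r.+1%:R <= K * q ^+ r.
Proof.
move=> q1; have t0 : 0 < q - 1 by rewrite subr_gt0.
have bern r : 1 + r%:R * (q - 1) <= q ^+ r.
  elim: r => [|r IHr]; first by rewrite mul0r addr0 expr0.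
  rewrite exprS -[r.+1]addn1 natrD.
  have r0 : 0 <= r%:R :> R by [].
  have := ler_wpM2l (ltW (lt_trans ltr01 q1)) IHr.
  have : 0 <= r%:R * (q - 1) * (q - 1) by rewrite !mulr_ge0 // ltW.
  lra.
exists (1 + (q - 1)^-1) => [|r]; first by rewrite addr_gt0 ?invr_gt0.
apply: le_trans (ler_wpM2l _ (bern r)); last by rewrite ltW // addr_gt0 ?invr_gt0.
have -> : (1 + (q - 1)^-1) * (1 + r%:R * (q - 1)) =
    r.+1%:R + (q - 1)^-1 + r%:R * (q - 1).
  by rewrite -[r.+1]addn1 natrD; field; rewrite gt_eqF.
by rewrite -addrA lerDl addr_ge0 ?invr_ge0 ?mulr_ge0 // ltW.
Qed.

Lemma geom_sum_le (R : realFieldType) (y : R) N : 0 <= y -> y < 1 ->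
  \sum_(0 <= r < N) y ^+ r <= (1 - y)^-1.
Proof.
move=> y0 y1; have y10 : 0 < 1 - y by rewrite subr_gt0.
rewrite -[leRHS]mul1r ler_pdivlMr // big_mkord mulrC.
by rewrite -opprB mulNr -subrX1 opprB gerBl exprn_ge0.
Qed.

Section CriticalBias.
Variables (R : realType) (G : groupType) (S : seq G).
Hypothesis S_gen : symmetric_gen_set S.
Hypothesis G_vZ : virtually_Z G.

Local Notation bsize r := (size (ball S r)).

(* The supremum of these rates is the radius of convergence of
   the power series with coefficients [h ^- bsize r]. *)
Definition ball_rate (h x : R) : Prop :=
  0 <= x /\ exists M, forall r, x ^+ r <= M * h ^+ bsize r.

(** Built from the number [h] and the ball sizes alone, so the threshold sees [H] only through its
    order. *)
Definition critical_bias (h : R) : R := sup (ball_rate h).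

Lemma ball_rate_self (h : R) : 1 <= h -> ball_rate h h.
Proof.
move=> h1; split; first exact: le_trans ler01 h1.
by exists 1 => r; rewrite mul1r ler_weXn2l // ltnW // (ball_size_ge S_gen).
Qed.

(** With balls of size at most C (r + 1), a rate x > h^C would keep (x / h^C)^r bounded. This makes
    the supremum finite. *)
Lemma ball_rate_ub (h : R) : 1 <= h -> exists U, forall x, ball_rate h x -> x <= U.
Proof.
move=> h1; have [C bC] := ball_size_le S_gen G_vZ.
exists (h ^+ C) => x [x0 [M xM]]; rewrite leNgt; apply/negP => hx.
have h0 : 0 < h ^+ C by rewrite exprn_gt0 // (lt_le_trans ltr01).
have [|K K0 Kr] := natr_le_geom (q := x / h ^+ C); first by rewrite ltr_pdivlMr ?mul1r.
have M0 : 0 <= M.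
  rewrite -(pmulr_lge0 _ (_ : 0 < h ^+ bsize 0)); last by rewrite exprn_gt0 // (lt_le_trans ltr01).
  by rewrite (le_trans _ (xM 0%N)).
have bound r : r.+1%:R <= K * (M * h ^+ C).
  apply: le_trans (Kr r) _; rewrite ler_wpM2l ?(ltW K0) // expr_div_n.
  rewrite (ler_pdivrMr _ _ (exprn_gt0 r h0)) -exprM -mulrA -exprD -mulnS.
  by apply: le_trans (xM r) _; rewrite ler_wpM2l // ler_weXn2l.
have [N hN] : exists N : nat, K * (M * h ^+ C) < N%:R.
  by eexists; apply: archi_boundP; rewrite !mulr_ge0 // ltW.
have := le_lt_trans (bound N) hN; rewrite ltr_nat.
by rewrite ltnNge leqnSn.
Qed.

Lemma ball_rate_le_critical (h x : R) : 1 <= h -> ball_rate h x -> x <= critical_bias h.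
Proof.
move=> h1 hx; have [U hU] := ball_rate_ub h1.
by apply: (ub_le_sup (E := ball_rate h)) => //; exists U.
Qed.

Lemma lt_critical_ball_rate (h lambda : R) : 1 <= h -> lambda < critical_bias h ->
  exists2 x, ball_rate h x & lambda < x.
Proof. by move=> h1; apply: sup_gt; exists h; apply: ball_rate_self. Qed.

Lemma gen_set_nonempty : (0 < size S)%N.
Proof. by have := ball_size_ge S_gen 1 G_vZ; case: S. Qed.

(** * Mean number of returns below and above the threshold *)

Variables (H : finGroupType) (lambda : R).
Local Notation h := (#|H|%:R : R).
Local Notation mean N := (@lamp_mean R G S H lambda N).

(** Pick a rate x > lambda and q > 1 with lambda q^4 <= x. Three factors q^r absorb the cubic
    polynomial, one from the ball size and two from the squared radius; the fourth leaves a
    convergent geometric series. *)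
Lemma lamp_mean_bounded : 1 <= lambda -> lambda < critical_bias h ->
  exists B, forall N, mean N <= B.
Proof.
have r2 r : (r.+2 <= 2 * r.+1)%N by lia.
move=> lambda1 /(lt_critical_ball_rate (card_group_ge1 R H))[x [x0 [M xM]] lx].
have l0 : 0 < lambda := lt_le_trans ltr01 lambda1.
have h0 : 0 < h := lt_le_trans ltr01 (card_group_ge1 R H).
have [C bC] := ball_size_le S_gen G_vZ.
(* For 0 <= t <= 1, (1 + t)^4 <= 1 + 15 t, as 4 + 6 + 4 + 1 = 15. The summand x - lambda in the
   denominator ensures t <= 1. *)
pose t := (x - lambda) / (15 * lambda + (x - lambda)); pose q := 1 + t.
have dl : 0 < x - lambda by rewrite subr_gt0.
have den0 : 0 < 15 * lambda + (x - lambda) by rewrite addr_gt0 // mulr_gt0.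
have t0 : 0 < t by rewrite divr_gt0.
have t1 : t <= 1 by rewrite ler_pdivrMr // mul1r; lra.
have tl : t * (15 * lambda + (x - lambda)) = x - lambda by rewrite divfK // gt_eqF.
have q0 : 0 < q by rewrite addr_gt0.
have q4 : lambda * q ^+ 4 <= x.
  have q15 : q ^+ 4 <= 1 + 15 * t.
    have t2 : t ^+ 2 <= t by rewrite expr2 ger_pMl.
    have t3 : t ^+ 3 <= t by rewrite exprS ger_pMr // exprn_ile1 // ltW.
    have t4 : t ^+ 4 <= t by rewrite exprS ger_pMr // exprn_ile1 // ltW.
    have -> : q ^+ 4 = 1 + 4 * t + 6 * t ^+ 2 + 4 * t ^+ 3 + t ^+ 4 by rewrite /q; ring.
    lra.
  apply: le_trans (ler_wpM2l (ltW l0) q15) _.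
  have : 0 <= t * (x - lambda) by rewrite mulr_ge0 // ltW.
  lra.
have q1 : 1 < q by rewrite ltrDl.
have [K K0 Kr] := natr_le_geom q1.
pose D : R := C%:R * 2 * (size S)%:R * K ^+ 3 * M.
have M0 : 0 <= M.
  rewrite -(pmulr_lge0 _ (_ : 0 < h ^+ bsize 0)); last by rewrite exprn_gt0.
  by rewrite (le_trans _ (xM 0%N)).
have y0 : 0 <= q^-1 by rewrite invr_ge0 ltW.
have y1 : q^-1 < 1 by rewrite invf_lt1.
exists (D * (1 - q^-1)^-1) => N.
apply: le_trans (lamp_mean_le H S_gen G_vZ gen_set_nonempty l0 N lambda1) _.
apply: (@le_trans _ _ (D * \sum_(0 <= r < N.+1) q^-1 ^+ r)); last first.
  by rewrite ler_wpM2l ?geom_sum_le // !mulr_ge0 ?exprn_ge0 ?(ltW K0).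
rewrite mulr_sumr; apply: ler_sum => r _.
have qr0 : 0 < q ^+ r by rewrite exprn_gt0.
have hb0 : 0 < h ^+ bsize r by rewrite exprn_gt0.
rewrite ler_pdivrMl // exprVn [leRHS]mulrA ler_pdivlMr //.
have bE : (bsize r.+1)%:R <= C%:R * 2 * r.+1%:R :> R.
  have -> : C%:R * 2 * r.+1%:R = (C * (2 * r.+1))%:R :> R by rewrite !natrM mulrA.
  by rewrite ler_nat; apply: leq_trans (bC r.+1) _; rewrite leq_mul2l r2 orbT.
set d : R := (size S)%:R; set n : R := r.+1%:R.
have n0 : 0 <= n by [].
have d0 : 0 <= d by [].
have lr0 : 0 <= lambda ^+ r by rewrite exprn_ge0 // ltW.
have dn0 : 0 <= d * n ^+ 2 * lambda ^+ r by rewrite mulr_ge0 // mulr_ge0 // exprn_ge0.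
have n3 : n ^+ 3 <= (K * q ^+ r) ^+ 3.
  by apply: lerXn2r (Kr r); rewrite nnegrE // mulr_ge0 ?ltW.
apply: (@le_trans _ _ (C%:R * 2 * d * (lambda ^+ r * q ^+ r) * n ^+ 3)).
  apply: (@le_trans _ _ ((C%:R * 2 * n) * (d * n ^+ 2 * lambda ^+ r) * q ^+ r)).
    by rewrite ler_wpM2r ?(ltW qr0) // ler_wpM2r.
  by rewrite le_eqVlt; apply/orP; left; apply/eqP; ring.
apply: (@le_trans _ _ (C%:R * 2 * d * (lambda ^+ r * q ^+ r) * (K * q ^+ r) ^+ 3)).
  by rewrite ler_wpM2l // !mulr_ge0 // ltW.
have -> : C%:R * 2 * d * (lambda ^+ r * q ^+ r) * (K * q ^+ r) ^+ 3 =
    C%:R * 2 * d * K ^+ 3 * (lambda * q ^+ 4) ^+ r.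
  by rewrite [(lambda * _) ^+ r]exprMn -exprM mulnC exprM; ring.
have -> : h ^+ bsize r * D = C%:R * 2 * d * K ^+ 3 * (M * h ^+ bsize r).
  by rewrite /D -/d; ring.
rewrite ler_wpM2l ?mulr_ge0 ?exprn_ge0 ?(ltW K0) //.
apply: le_trans (xM r); apply: lerXn2r; rewrite ?nnegrE //.
by rewrite mulr_ge0 ?exprn_ge0 ?ltW.
Qed.

(** If the means were bounded, the lower bound on each ball would make a number strictly above the
    supremum a rate. *)
Lemma lamp_mean_unbounded : critical_bias h < lambda ->
  forall B, exists N, B < mean N.
Proof.
move=> lc B; have h1 := card_group_ge1 R H.
apply: contrapT => no_N.
have le_B N : mean N <= B by rewrite leNgt; apply/negP => BN; apply: no_N; exists N.
have h0 : 0 < h := lt_le_trans ltr01 h1.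
have c0 : 0 < critical_bias h.
  by apply: lt_le_trans h0 _; apply: ball_rate_le_critical => //; apply: ball_rate_self.
have l0 : 0 < lambda := lt_trans c0 lc.
(* The gap between [x] and [lambda] leaves the geometric factor (lambda / x)^r to absorb the ball
   size. *)
pose x := (critical_bias h + lambda) / 2.
have x0 : 0 < x by rewrite /x; lra.
have xl : x < lambda by rewrite /x; lra.
have cx : critical_bias h < x by rewrite /x; lra.
have [|K K0 Kr] := natr_le_geom (q := lambda / x); first by rewrite ltr_pdivlMr ?mul1r.
have [C bC] := ball_size_le S_gen G_vZ.
suff : ball_rate h x by move/(ball_rate_le_critical h1); rewrite leNgt cx.
split; first exact: ltW.
have B0 : 0 <= B.
  exact: le_trans (le_B 0%N).
(* The 2 is that of [green_ball_ge], [C] and [K] bound the ball size by C K (lambda / x)^r, and the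
   1 added to [B] pays for time 0. *)
exists (2 * C%:R * K * (B + 1)) => r.
have [N gN] := green_ball_ge S_gen gen_set_nonempty l0 r.
have := le_trans (lamp_mean_ge H S_gen gen_set_nonempty l0 r N) (le_B N).
set g := green _ _ _ _ _ _ in gN *; rewrite mulrBr mulr1.
have hb0 : 0 < h ^+ bsize r by rewrite exprn_gt0.
have hb1 : (h ^+ bsize r)^-1 <= 1 by rewrite invf_le1 // exprn_ege1.
move=> gB; have {gB} : (h ^+ bsize r)^-1 * g <= B + 1 by lra.
rewrite ler_pdivrMl // => gB.
have b0 : 0 < (bsize r)%:R :> R by rewrite ltr0n (leq_ltn_trans _ (ball_size_ge S_gen r G_vZ)).
move: (le_trans gN gB); rewrite ler_pdivrMr ?mulr_gt0 // => lB.
have lx0 : 0 < (lambda / x) ^+ r by rewrite exprn_gt0 // divr_gt0.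
have -> : x ^+ r = lambda ^+ r / (lambda / x) ^+ r.
  by rewrite [(lambda / x) ^+ r]expr_div_n; field; rewrite !expf_neq0 ?gt_eqF.
rewrite ler_pdivrMr //; apply: le_trans lB _.
have bE : (bsize r)%:R <= C%:R * (K * (lambda / x) ^+ r).
  apply: (@le_trans _ _ (C%:R * r.+1%:R)); first by rewrite -natrM ler_nat.
  by rewrite ler_wpM2l.
have e0 : 0 <= h ^+ bsize r * (B + 1) * 2 by rewrite !mulr_ge0 ?(ltW hb0) // addr_ge0.
rewrite mulrA; apply: le_trans (ler_wpM2l e0 bE) _.
by rewrite le_eqVlt; apply/orP; left; apply/eqP; ring.
Qed.

End CriticalBias.

Theorem theorem1p3 (R : realType) (G : groupType) (S : seq G) :
  symmetric_gen_set S -> virtually_Z G ->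
  exists lambda_c : nat -> R,
    forall H : finGroupType, (1 < #|H|)%N ->
      1 < lambda_c #|H| /\
      (forall lambda : R, 1 <= lambda -> lambda < lambda_c #|H| ->
         lamp_transient S H lambda) /\
      (forall lambda : R, lambda_c #|H| < lambda ->
         lamp_recurrent S H lambda).
Proof.
move=> S_gen G_vZ; have S0 := gen_set_nonempty S_gen G_vZ.
exists (fun n => critical_bias S (n%:R : R)) => H H1.
have h1 := card_group_ge1 R H.
have c1 : 1 < critical_bias S (#|H|%:R : R).
  apply: (@lt_le_trans _ _ #|H|%:R); first by rewrite ltr1n.
  by apply: (ball_rate_le_critical S_gen) => //; apply: ball_rate_self.
have is_idP (st : lstate G H) : is_id st -> st = lstate_id G H by move/asboolP.
split=> //; split=> [lambda l1 lc|lambda lc].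
  have l0 : 0 < lambda := lt_le_trans ltr01 l1.
  have [B HB] := lamp_mean_bounded S_gen G_vZ l1 lc.
  move=> eps eps0.
  have arch : exists k : nat, B / eps < k%:R.
    exists (Num.bound `|B / eps|).
    exact: le_lt_trans (ler_norm _) (archi_boundP (normr_ge0 _)).
  have [m Hm] := bounded_mean_returns_transient (lamp_weight_ge0 S_gen S0 l0)
    (lamp_weight_sum S_gen S0 l0) HB eps0 arch.
  by exists m => N; rewrite prob_uptoE; apply: Hm.
have l0 : 0 < lambda := lt_trans (lt_trans ltr01 c1) lc.
move=> m eps eps0.
have [N HN] := unbounded_mean_returns_recurrent (lamp_weight_ge0 S_gen S0 l0)
  (lamp_weight_sum S_gen S0 l0) is_idP (lamp_mean_unbounded S_gen G_vZ lc) m eps0.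
by exists N; rewrite prob_uptoE; apply: HN.
Qed.
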